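(* Let $t\in\mathbb{R}\setminus\{0\}$, and let $A\in U$ (with $A\in U_d$ in the case $t=d\in\mathbb{Z}_{\ge1}$). (1) (Law of large numbers for $\boxplus^t$) If $\kappa_1^t(A)=\lambda$, then $$D_{1/m}\bigl[A^{\boxplus^tm}\bigr](z)\to B_\lambda^{(t)}(z)\qquad\text{as } m\to\infty .$$ (2) (Central limit theorem for $\boxplus^t$) If $\kappa_1^t(A)=0$ and $\kappa_2^t(A)=1$, then $$D_{1/\sqrt m}\bigl[A^{\boxplus^tm}\bigr](z)\to H^{(t)}(z)\qquad\text{as } m\to\infty .$$ Convergence is convergence of every coefficient.
   Context: $(t)_{\underline{k}}=t(t-1)\cdots(t-k+1)$, $(t)_{\underline{0}}=1$. $U=1+z\mathbb{R}\llbracket z\rrbracket$; for $d\in\mathbb{Z}_{\ge1}$, $U_d\subset U$ is the set of polynomials of degree at most $d$ with constant term $1$. For $t\in\mathbb{R}\setminus\mathbb{Z}_{\ge0}$, and $A=\sum a_kz^k$, $B=\sum b_kz^k$ in $\mathbb{R}\llbracket z\rrbracket$, $$(A\boxplus^tB)(z)=\sum_{k=0}^\infty\sum_{i+j=k}\frac{(t)_{\underline{k}}}{(t)_{\underline{i}}(t)_{\underline{j}}}a_ib_jz^k .$$ For $t=d\in\mathbb{Z}_{\ge1}$, $\boxplus^d$ is defined on polynomials in $z$ of degree at most $d$ by the same formula with the outer sum over $0\le k\le d$. The $m$-fold power is $A^{\boxplus^tm}=A\boxplus^t\cdots\boxplus^tA$ ($m$ times). The $t$-deformed cumulants $\kappa_i^t(A)$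 are defined, with $\log$ the formal logarithm, by $$\sum_{i=1}^\infty\kappa_i^t(A)z^i=-\frac{z}{t}\frac{d}{dz}\log\left(1+\sum_{k\ge1}\frac{t^k}{(t)_{\underline{k}}}a_kz^k\right),$$ where for $t=d\in\mathbb{Z}_{\ge1}$ and $A\in U_d$ the inner sum runs over $1\le k\le d$. The dilation is $D_r[A](z)=A(rz)$. The $t$-deformed binomial series is $B_\lambda^{(t)}(z)=(1-\lambda z)^t=1+\sum_{k=1}^\infty(-1)^k\frac{(t)_{\underline{k}}}{k!}\lambda^kz^k$, and the $t$-deformed Hermite series is $H^{(t)}(z)=1+\sum_{k=1}^\infty(-1)^k\frac{(t)_{\underline{2k}}}{t^k(2k)!!}z^{2k}$, where $(2k)!!=2^kk!$. The ring $\mathbb{R}\llbracket z\rrbracket$ carries the product topology (coefficientwise convergence). *)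

(* Defs.v *)
From HB Require Import structures.
From mathcomp Require Import all_boot all_order all_algebra.
From mathcomp Require Import all_classical all_reals all_analysis.
Set Implicit Arguments.
Unset Strict Implicit.
Unset Printing Implicit Defensive.
Import Order.TTheory GRing.Theory Num.Theory.
Import numFieldNormedType.Exports.
Local Open Scope classical_set_scope.
Local Open Scope ring_scope.

(* A formal power series is its sequence of coefficients. The pointwise ring
   structure that functions carry in MathComp is not the one of power series;
   multiplicative operations below are therefore given explicitly. *)
Definition fps (R : realType) : Type := nat -> R.

Section FormalPowerSeries.
Context {R : realType}.
Implicit Types (f g : fps R) (k n : nat).

Definition fps_one : fps R := fun k => (k == 0%N)%:R.

Definition fps_sub f g : fps R := fun k => f k - g k.

Definition fps_mul f g : fps R :=
  fun k => \sum_(i < k.+1) f i * g (k - i)%N.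

Definition fps_pow f n : fps R := iter n (fps_mul f) fps_one.

Definition fps_scale (c : R) f : fps R := fun k => c * f k.

Definition fps_mulX f : fps R := fun k => if k is k'.+1 then f k' else 0.

Definition fps_deriv f : fps R := fun k => k.+1%:R * f k.+1.

(* log f = \sum_(n >= 1) (-1)^(n-1) / n (f - 1)^n, for f with constant term 1.
   The coefficient of z^k in (f - 1)^n vanishes for n > k, so the sum defining
   the k-th coefficient stops at n = k. *)
Definition fps_log f : fps R := fun k =>
  \sum_(1 <= n < k.+1) (-1) ^+ n.-1 / n%:R * fps_pow (fps_sub f fps_one) n k.

Definition dilation (r : R) f : fps R := fun k => r ^+ k * f k.

Definition inU f : Prop := f 0%N = 1.

Definition inUd (d : nat) f : Prop :=
  inU f /\ forall k, (d < k)%N -> f k = 0.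

End FormalPowerSeries.

Section DeformedConvolution.
Context {R : realType}.
Implicit Types (t : R) (A B : fps R) (k m : nat).

Definition falling t k : R := \prod_(i < k) (t - i%:R).

(* The same formula serves t = d a positive integer: the coefficients of index
   k > d vanish since falling d k = 0, and for k <= d no denominator is 0. *)
Definition boxplus t A B : fps R := fun k =>
  \sum_(i < k.+1)
     falling t k / (falling t i * falling t (k - i)%N) * (A i * B (k - i)%N).

Definition boxpow t A m : fps R := iterop m (boxplus t) A fps_one.

(* When t = d is a positive integer and A has degree at most d, the terms of
   index k > d are 0 because A k = 0. *)
Definition cumulant_gen t A : fps R := fun k =>
  if k == 0%N then 1 else t ^+ k / falling t k * A k.

Definition cumulant t A : fps R :=
  fps_scale (- t^-1) (fps_mulX (fps_deriv (fps_log (cumulant_gen t A)))).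

Definition binomial_series t (lambda : R) : fps R := fun k =>
  (-1) ^+ k * (falling t k / k`!%:R) * lambda ^+ k.

Definition hermite_series t : fps R := fun n =>
  if odd n then 0
  else (-1) ^+ n./2 *
       (falling t n / (t ^+ n./2 * (2 ^ n./2 * (n./2)`!)%:R)).

End DeformedConvolution.

(* Main.v *)
Require Import Defs.
From HB Require Import structures.
From mathcomp Require Import all_boot all_order all_algebra.
From mathcomp Require Import all_classical all_reals all_analysis.
From mathcomp Require Import ring.
Import Order.TTheory GRing.Theory Num.Theory.
Import numFieldNormedType.Exports.
Local Open Scope classical_set_scope.
Local Open Scope ring_scope.

(** Dividing the k-th coefficient by the falling factorial (t)_k turns the
    convolution into the ordinary Cauchy product: if P is the series with
    coefficients a_k / (t)_k, then the k-th coefficient of the m-fold power is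
    (t)_k [z^k] P^m ([boxpowE]). When t = d is a positive integer this division
    is harmless, because a_k = 0 wherever (t)_k = 0. Only finitely many
    coefficients matter for a given k, so P may be taken to be a polynomial.

    Both limit theorems are then the same statement about ordinary powers
    ([coef_exp_cvg]). If P = 1 + z^p Q, the binomial theorem gives
      [z^k] P^m = sum_n C(m, n) [z^(k - p n)] Q^n,
    where only the n with p n <= k contribute. Since C(m, n) ~ m^n / n!,
    rescaling z by m^(-1/p) kills all the terms with p n < k and leaves
    Q(0)^n / n! for p n = k: the limit is exp(Q(0) z^p). The first cumulant says
    that P = 1 - lambda z + ..., which with p = 1 yields exp(- lambda z); if it
    vanishes, the second one says that P = 1 - z^2 / (2 t) + ..., which with
    p = 2 yields exp(- z^2 / (2 t)). Multiplying the coefficients by (t)_k again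
    produces the binomial and the Hermite series. *)

(** * Powers of a polynomial under rescaling *)

Section PowerLimit.
Context {R : realType}.
Implicit Types (P Q : {poly R}) (k m n p : nat).

Lemma invn_cvg0 : (m%:R^-1 : R) @[m --> \oo] --> (0 : R).
Proof. by rewrite -cvg_shiftS; exact: cvg_harmonic. Qed.

(** C(m, n) ~ m^n / n!, by induction from (n + 1) C(m, n + 1) = (m - n) C(m, n). *)
Lemma bin_cvg n :
  ('C(m, n)%:R * m%:R^-1 ^+ n : R) @[m --> \oo] --> (n`!%:R^-1 : R).
Proof.
elim: n => [|n IHn].
  rewrite fact0 invr1; under eq_cvg do rewrite bin0 expr0 mulr1.
  exact: cvg_cst.
have step : \forall m \near \oo,
    ('C(m, n)%:R * m%:R^-1 ^+ n) * ((1 - n%:R * m%:R^-1) * n.+1%:R^-1) =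
    ('C(m, n.+1)%:R * m%:R^-1 ^+ n.+1 : R).
  near=> m.
  have m0 : (m%:R : R) != 0 by rewrite pnatr_eq0 -lt0n; near: m; exists 1%N.
  have lenm : (n <= m)%N by near: m; exists n.
  have : (n.+1%:R * 'C(m, n.+1)%:R : R) = (m%:R - n%:R) * 'C(m, n)%:R.
    by rewrite -natrB // -!natrM mul_bin_left.
  move=> /(congr1 (fun x => n.+1%:R^-1 * x)); rewrite mulKf ?pnatr_eq0 // => ->.
  by rewrite exprS; field; rewrite m0 /= addrC natr1 pnatr_eq0.
apply: cvg_trans; first exact: near_eq_cvg step.
have -> : (n.+1`!%:R^-1 : R) = n`!%:R^-1 * ((1 - n%:R * 0) * n.+1%:R^-1).
  by rewrite mulr0 subr0 mul1r factS natrM invfM mulrC.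
apply: cvgM => //; apply: cvgM; last exact: cvg_cst.
apply: cvgB; first exact: cvg_cst.
by apply: cvgM; [exact: cvg_cst | exact: invn_cvg0].
Unshelve. all: by end_near. Qed.

Lemma coef0_exp Q n : (Q ^+ n)`_0 = Q`_0 ^+ n.
Proof. by rewrite -!horner_coef0 horner_exp. Qed.

(** The summation range is made independent of m: the binomial coefficient
    vanishes for n > m, and the shift by p n exceeds k for n > k. *)
Lemma coef_exp_1DXn Q p m k : (0 < p)%N ->
  ((1 + 'X^p * Q) ^+ m)`_k =
  \sum_(n < k.+1) 'C(m, n)%:R * (if (k < p * n)%N then 0
                                 else (Q ^+ n)`_(k - p * n)).
Proof.
move=> p0.
pose F n := 'C(m, n)%:R * (if (k < p * n)%N then 0
                           else (Q ^+ n)`_(k - p * n)).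
have -> : ((1 + 'X^p * Q) ^+ m)`_k = \sum_(n < m.+1) F n.
  rewrite exprDn coef_sum; apply: eq_bigr => n _.
  by rewrite expr1n mul1r exprMn -exprM coefMn coefXnM -[LHS]mulr_natl.
have widen N : (N <= m + k)%N -> (forall n, (N < n)%N -> F n = 0) ->
    \sum_(n < N.+1) F n = \sum_(n < (m + k).+1) F n.
  move=> leN F0; rewrite (big_ord_widen (m + k).+1 F) // big_mkcond.
  by apply: eq_bigr => n _; rewrite ltnS; case: leqP => // /F0.
rewrite (widen m) ?leq_addr // => [|n lemn]; last by rewrite /F bin_small ?mul0r.
rewrite -(widen k) ?leq_addl // => n lekn.
by rewrite /F (leq_trans lekn) ?mulr0 // leq_pmull.
Qed.

(** The n-th term carries the weight C(m, n) r^k ~ r^(k - p n) / n!, so that of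
    all the terms only the one with p n = k survives. *)
Lemma coef_exp_cvg Q p (r : nat -> R) k : (0 < p)%N ->
  (forall m, r m ^+ p = m%:R^-1) -> r m @[m --> \oo] --> (0 : R) ->
  r m ^+ k * ((1 + 'X^p * Q) ^+ m)`_k @[m --> \oo]
    --> (if (p %| k)%N then Q`_0 ^+ (k %/ p) / (k %/ p)`!%:R else 0).
Proof.
move=> p0 rp r0.
pose c n : R := if (p * n == k)%N then Q`_0 ^+ n / n`!%:R else 0.
have -> : (if (p %| k)%N then Q`_0 ^+ (k %/ p) / (k %/ p)`!%:R else 0) =
          \sum_(n < k.+1) c n.
  have [/dvdnP [q kE]|ndvd] := boolP (p %| k)%N; last first.
    rewrite big1 // => n _; rewrite /c; case: eqP => // eqk.
    by rewrite -eqk dvdn_mulr in ndvd.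
  have ltq : (q < k.+1)%N by rewrite kE ltnS leq_pmulr.
  rewrite [in LHS]kE mulnK // (bigD1 (Ordinal ltq)) //= big1 ?addr0 => [|n].
    by rewrite /c /= kE mulnC eqxx.
  by rewrite -val_eqE /c /= [X in (p * _)%N == X]kE mulnC eqn_pmul2r // => /negPf ->.
under eq_cvg do rewrite coef_exp_1DXn // big_distrr.
apply: cvg_big => [|n _]; first exact: add_continuous.
rewrite /c /=; case: ltngtP => [_|ltk|eqk].
- under eq_cvg do rewrite !mulr0.
  exact: cvg_cst.
- set q := (Q ^+ n)`_(k - p * n).
  have eqF m : r m ^+ k * ('C(m, n)%:R * q) =
      'C(m, n)%:R * m%:R^-1 ^+ n * r m ^+ (k - p * n) * q.
    by rewrite -{1}(subnKC (ltnW ltk)) exprD exprM rp; ring.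
  have -> : (0 : R) = n`!%:R^-1 * 0 ^+ (k - p * n) * q.
    by rewrite expr0n subn_eq0 leqNgt ltk mulr0 mul0r.
  under eq_cvg do rewrite eqF.
  apply: cvgM; last exact: cvg_cst.
  apply: cvgM; first exact: bin_cvg.
  exact: (continuous_cvg _ (@exprn_continuous _ _ _) r0).
- have eqF m : r m ^+ k * ('C(m, n)%:R * (Q ^+ n)`_(k - p * n)) =
      Q`_0 ^+ n * ('C(m, n)%:R * m%:R^-1 ^+ n).
    by rewrite -eqk subnn coef0_exp [in r m ^+ _]eqk exprM rp; ring.
  under eq_cvg do rewrite eqF.
  by apply: cvgM; [exact: cvg_cst | exact: bin_cvg].
Qed.

End PowerLimit.

(** * The deformed convolution as a Cauchy product *)

Section Linearization.
Context {R : realType}.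
Implicit Types (t : R) (A B : fps R) (P Q : {poly R}) (i k m n p : nat).

Lemma falling0 t : falling t 0 = 1.
Proof. by rewrite /falling big_ord0. Qed.

Lemma falling1 t : falling t 1 = t.
Proof. by rewrite /falling big_ord1 subr0. Qed.

Lemma falling_neq0_le t i k : (i <= k)%N -> falling t k != 0 -> falling t i != 0.
Proof.
move=> leik /prodf_neq0 nz; apply/prodf_neq0 => j _.
exact: (nz (widen_ord leik j)).
Qed.

(** (t)_k vanishes only if t is one of 0, ..., k - 1; being nonzero, t is then a
    degree bound d with 0 < d < k. This is what allows coefficients to be divided
    by falling factorials in the integral case. *)
Lemma falling_eq0 t A k : t != 0 ->
  (forall d : nat, (1 <= d)%N -> t = d%:R -> inUd d A) ->
  falling t k = 0 -> A k = 0.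
Proof.
move=> t0 hUd /eqP /prodf_eq0 [i _]; rewrite subr_eq0 => /eqP ti.
have i0 : (0 < i)%N by rewrite lt0n; apply: contra_neq t0; rewrite ti => ->.
by have [_ ->] := hUd _ i0 ti.
Qed.

(** The weight (t)_k / ((t)_i (t)_(k - i)) cancels the normalization of the two
    factors and leaves (t)_k. If (t)_k = 0, both sides vanish, whatever the
    value given to divisions by 0. *)
Lemma boxplusE t A B P Q k :
  (forall i, (i <= k)%N -> A i = falling t i * P`_i) ->
  (forall i, (i <= k)%N -> B i = falling t i * Q`_i) ->
  boxplus t A B k = falling t k * (P * Q)`_k.
Proof.
move=> AP BQ; rewrite /boxplus coefM mulr_sumr; apply: eq_bigr => i _.
have leik : (i <= k)%N by rewrite -ltnS.
have [->|fk] := eqVneq (falling t k) 0; first by rewrite !mul0r.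
rewrite AP // BQ ?leq_subr //; field.
by rewrite !(falling_neq0_le _ _ _ _ fk) ?leq_subr.
Qed.

(** The bound n lets P be a truncation of the normalized series of A, so that
    polynomials suffice. *)
Lemma boxpowE t A P n m k :
  (forall i, (i <= n)%N -> A i = falling t i * P`_i) ->
  (k <= n)%N -> boxpow t A m k = falling t k * (P ^+ m)`_k.
Proof.
move=> AP; case: m => [|m]; first by rewrite coef1; case: k => [|k] _;
  rewrite /boxpow /= /fps_one ?falling0 ?mulr1 ?mulr0.
rewrite /boxpow iteropS; elim: m k => [|m IHm] k lekn; first exact: AP.
rewrite exprS; apply: boxplusE => i leik; first exact: AP (leq_trans leik lekn).
exact: IHm (leq_trans leik lekn).
Qed.

(** * Limits of the rescaled powers *)

(** The common form of the two limit theorems: the coefficients of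
    (t)_k [z^k] exp(c z^p), where c is the first nontrivial normalized
    coefficient a_p / (t)_p. *)
Lemma dilation_boxpow_cvg t A p (r : nat -> R) k :
  t != 0 -> inU A ->
  (forall d : nat, (1 <= d)%N -> t = d%:R -> inUd d A) ->
  (0 < p)%N -> (forall i, (0 < i < p)%N -> A i / falling t i = 0) ->
  (forall m, r m ^+ p = m%:R^-1) -> r m @[m --> \oo] --> (0 : R) ->
  dilation (r m) (boxpow t A m) k @[m --> \oo]
    --> falling t k *
        (if (p %| k)%N
         then (A p / falling t p) ^+ (k %/ p) / (k %/ p)`!%:R else 0).
Proof.
move=> t0 U Ud p0 Alow rp r0.
pose P : {poly R} := \poly_(i < (k + p).+1) (A i / falling t i).
have AP i : (i <= k + p)%N -> A i = falling t i * P`_i.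
  move=> lei; rewrite coef_poly ltnS lei.
  have [f0|f0] := eqVneq (falling t i) 0; last by rewrite mulrC divfK.
  by rewrite f0 mul0r (falling_eq0 t A).
have PE : P = 1 + 'X^p * drop_poly p P.
  rewrite -[LHS](poly_take_drop p) [_ * 'X^p]mulrC; congr (_ + _).
  apply/polyP => i; rewrite coef_take_poly coef1 coef_poly.
  case: i => [|i]; first by rewrite p0 /= U falling0 divr1.
  by case: ltnP => // ltip; rewrite Alow ?if_same.
have Q0 : (drop_poly p P)`_0 = A p / falling t p.
  by rewrite coef_drop_poly add0n coef_poly ltnS leq_addl.
have boxE m : dilation (r m) (boxpow t A m) k =
    falling t k * (r m ^+ k * ((1 + 'X^p * drop_poly p P) ^+ m)`_k).
  by rewrite -PE /dilation (boxpowE _ _ _ _ _ _ AP) ?leq_addr //; ring.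
under eq_cvg do rewrite boxE.
apply: cvgM; first exact: cvg_cst.
by rewrite -Q0; exact: coef_exp_cvg.
Qed.

Lemma cumulant1E t A : t != 0 -> cumulant t A 1 = - (A 1%N / falling t 1).
Proof.
move=> t0; rewrite /cumulant /fps_scale /fps_mulX /= /fps_deriv /fps_log big_nat1.
rewrite /fps_pow /= /fps_mul 2!big_ord_recl big_ord0 /= /fps_sub /fps_one /=.
by rewrite /cumulant_gen /= falling1; field.
Qed.

(** The general formula for the second cumulant also contains the square of the
    first one. *)
Lemma cumulant2E t A : t != 0 -> cumulant t A 1 = 0 ->
  cumulant t A 2 = - (t * (A 2%N / falling t 2) *+ 2).
Proof.
move=> t0; rewrite cumulant1E // => /eqP; rewrite oppr_eq0 => /eqP A1.
rewrite /cumulant /fps_scale /fps_mulX /= /fps_deriv /fps_log.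
rewrite big_nat_recr //= big_nat1 /fps_pow /= /fps_mul.
rewrite !big_ord_recl !big_ord0 /= /bump /= /fps_sub /fps_one /=.
rewrite /cumulant_gen /=.
have -> : t ^+ 1 / falling t 1 * A 1%N = 0.
  by rewrite -mulrA [_^-1 * _]mulrC A1 mulr0.
by move: (falling t 2)^-1 => f; field.
Qed.

End Linearization.

Theorem theorem2p13 (R : realType) (t : R) (A : fps R)
    (ht : t != 0)
    (hU : inU A)
    (hUd : forall d : nat, (1 <= d)%N -> t = d%:R -> inUd d A) :
  (forall lambda : R, cumulant t A 1%N = lambda ->
     forall k : nat,
       dilation m%:R^-1 (boxpow t A m) k @[m --> \oo]
         --> binomial_series t lambda k)
  /\
  (cumulant t A 1%N = 0 -> cumulant t A 2%N = 1 ->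
     forall k : nat,
       dilation (Num.sqrt m%:R)^-1 (boxpow t A m) k @[m --> \oo]
         --> hermite_series t k).
Proof.
split=> [lambda kappa1 k | kappa1 kappa2 k].
  have A1 : A 1%N / falling t 1 = - lambda by rewrite -kappa1 cumulant1E ?opprK.
  have -> : binomial_series t lambda k =
      falling t k * (if (1 %| k)%N
        then (A 1%N / falling t 1) ^+ (k %/ 1) / (k %/ 1)`!%:R else 0).
    by rewrite dvd1n divn1 A1 exprNn /binomial_series; ring.
  apply: (dilation_boxpow_cvg t A 1 (fun m => m%:R^-1)) => //.
    by move=> i; rewrite ltnS leqn0 andbC; case: eqP => // ->.
  exact: invn_cvg0.
have A1 : A 1%N / falling t 1 = 0.
  by apply/eqP; rewrite -oppr_eq0 -cumulant1E // kappa1.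
have A2 : A 2%N / falling t 2 = - (t * 2)^-1.
  move: kappa2; rewrite cumulant2E // => /(congr1 (fun x => - (t * 2)^-1 * x)).
  by rewrite mulr1 => <-; move: (_ / _) => a; field.
have -> : hermite_series t k =
    falling t k * (if (2 %| k)%N
      then (A 2%N / falling t 2) ^+ (k %/ 2) / (k %/ 2)`!%:R else 0).
  rewrite /hermite_series dvdn2 divn2; case: (odd k); first by rewrite mulr0.
  rewrite /= A2 [(- _^-1) ^+ _]exprNn exprVn exprMn natrM natrX; field.
  by rewrite !expf_neq0 ?pnatr_eq0 -?lt0n ?fact_gt0.
apply: (dilation_boxpow_cvg t A 2 (fun m => (Num.sqrt m%:R)^-1)) => //.
- by case=> [|[|i]].
- by move=> m; rewrite exprVn sqr_sqrtr.
rewrite -sqrtr0; under eq_cvg do rewrite -sqrtrV //.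
exact: (continuous_cvg _ (@sqrt_continuous _ _) invn_cvg0).
Qed.
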